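(* There exist positive constants $C$ and $r_0$ such that for all $r\ge r_0$, \[ 2^{\log^2 r/36} \le F_\chi(r,4,3) \le C\cdot 2^{130\sqrt{r\log r}}. \]
   Context: Logarithms are base 2. A graph is $p$-chromatic if its chromatic number is exactly $p$. For $p\ge3$, $2\le q\le\binom p2$ and positive integer $r$, $F_\chi(r,p,q)$ is the minimum integer $n$ such that every edge coloring of $K_n$ with $r$ colors contains a $p$-chromatic subgraph whose edges receive at most $q-1$ distinct colors. *)

(* Defs.v *)
From Stdlib Require Import Reals.
From mathcomp Require Import all_boot.

Set Implicit Arguments.
Unset Strict Implicit.
Unset Printing Implicit Defensive.

(* An edge coloring of K_n with r colors: a symmetric map c u v (values on
   the diagonal are irrelevant). *)
Definition sym_coloring (n r : nat) (c : 'I_n -> 'I_n -> 'I_r) : Prop :=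
  forall u v : 'I_n, c u v = c v u.

(* A subgraph of K_n is given by its edge set E : set of pairs (u,v) with
   u != v (each pair an edge {u,v}). *)
Definition loopless (n : nat) (E : {set 'I_n * 'I_n}) : Prop :=
  forall e, e \in E -> e.1 != e.2.

Definition colorable (n k : nat) (E : {set 'I_n * 'I_n}) : Prop :=
  exists f : 'I_n -> 'I_k, forall e, e \in E -> f e.1 != f e.2.

Definition p_chromatic (n p : nat) (E : {set 'I_n * 'I_n}) : Prop :=
  colorable p E /\ ~ colorable p.-1 E.

Definition colors_of (n r : nat) (c : 'I_n -> 'I_n -> 'I_r)
  (E : {set 'I_n * 'I_n}) : {set 'I_r} :=
  [set c e.1 e.2 | e in E].

Definition Fchi_prop (r p q n : nat) : Prop :=
  forall c : 'I_n -> 'I_n -> 'I_r, sym_coloring c ->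
    exists E : {set 'I_n * 'I_n},
      [/\ loopless E, p_chromatic p E & #|colors_of c E| <= q.-1].

Definition is_Fchi (r p q n : nat) : Prop :=
  Fchi_prop r p q n /\ forall m, m < n -> ~ Fchi_prop r p q m.

Definition log2 (x : R) : R := Rdiv (ln x) (ln 2).

(* Main.v *)
(* Lower bound: in Mubayi's coloring of words, the union of any two color classes is
   3-colorable; with 2 ^ t letters and words of length t this colors K_n for
   n = 2 ^ (t ^ 2) with 2 ^ (3 t) colors.

   Upper bound: suppose all unions of two of the k colors are 3-colorable, with
   k <= r.  Let red be a densest color and f_j a 3-coloring of red + j.  If f_j u <> f_j w,
   then f_j is constant on the common red neighborhood of u and w, which therefore
   contains no edge of color j.  Dependent random choice gives a red neighborhood Y in
   which almost all pairs have at least n / poly(r) common red neighbors.  Either one can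
   shed about sqrt(k log r) colors by repeatedly passing from Y to subsets omitting only a
   fraction of about sqrt(log r / k), or some set inside Y has the property that every
   f_j is spread out on it; then a pair (u, w) in that set is separated by that many f_j.  In
   both cases a factor poly(r) in the number of vertices pays for sqrt(k log r) colors,
   so induction on k gives log n = O(sqrt(r log r)). *)
Require Import Defs.
From Stdlib Require Import Reals Lra Classical.
From mathcomp Require Import all_boot zify.

Set Implicit Arguments.
Unset Strict Implicit.
Unset Printing Implicit Defensive.

(** * Pairwise 3-colorable edge colorings and palettes of vertex sets *)

Definition proper_for (T C : finType) (c : T -> T -> C) (j : C)
  (f : T -> 'I_3) : Prop :=
  forall u v, u != v -> c u v = j -> f u != f v.

Definition pairwise_3colorable (T C : finType) (c : T -> T -> C) : Prop :=
  forall i j, exists f : T -> 'I_3, proper_for c i f /\ proper_for c j f.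

Definition palette (T C : finType) (c : T -> T -> C) (V : {set T}) : {set C} :=
  [set j | [exists u in V, exists v in V, (u != v) && (c u v == j)]].

Lemma paletteP (T C : finType) (c : T -> T -> C) (V : {set T}) j :
  reflect (exists u v, [/\ u \in V, v \in V, u != v & c u v = j])
          (j \in palette c V).
Proof.
rewrite inE; apply: (iffP existsP) => [[u /andP[uV /existsP[v]]]|].
  by case/and3P=> vV nuv /eqP cuv; exists u, v.
case=> u [v [uV vV nuv cuv]]; exists u; rewrite uV; apply/existsP; exists v.
by rewrite vV nuv cuv eqxx.
Qed.

Lemma palette_sub (T C : finType) (c : T -> T -> C) (A B : {set T}) :
  A \subset B -> palette c A \subset palette c B.
Proof.
move=> /subsetP AB; apply/subsetP=> j /paletteP[u [v [uA vA nuv cuv]]].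
by apply/paletteP; exists u, v; split; rewrite ?AB.
Qed.

Lemma palette_const (T C : finType) (c : T -> T -> C) (V : {set T}) j f :
  proper_for c j f -> {in V &, forall u v, f u = f v} -> j \notin palette c V.
Proof.
move=> fP fc; apply/negP=> /paletteP[u [v [uV vV nuv cuv]]].
by have := fP _ _ nuv cuv; rewrite (fc u v) ?eqxx.
Qed.

Lemma palette_lose (T C : finType) (c : T -> T -> C) (A B : {set T})
    (S : {set C}) :
  A \subset B -> S \subset palette c B -> [disjoint S & palette c A] ->
  #|S| + #|palette c A| <= #|palette c B|.
Proof.
move=> AB SB dS; have := subset_leq_card (_ : S :|: palette c A \subset palette c B).
rewrite cardsU (_ : S :&: _ = set0) ?cards0 ?subn0; first by apply; rewrite subUset SB palette_sub.
by apply/eqP; rewrite setI_eq0.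
Qed.

Lemma palette_lt (T C : finType) (c : T -> T -> C) (A B : {set T}) j :
  A \subset B -> j \in palette c B -> j \notin palette c A ->
  #|palette c A| < #|palette c B|.
Proof.
move=> AB jB jA; apply: proper_card; rewrite properE palette_sub //=.
by apply/subsetPn; exists j.
Qed.

Lemma exists_lt_of_sum (I : finType) (A : {set I}) (F G : I -> nat) :
  \sum_(i in A) F i < \sum_(i in A) G i -> exists2 i, i \in A & F i < G i.
Proof.
move=> FG; apply/exists_inP; apply: contraLR FG; rewrite negb_exists -leqNgt.
move=> /forallP FG; apply: leq_sum => i iA; rewrite leqNgt.
by have := FG i; rewrite iA.
Qed.

(** A 3-coloring of one color class splits [V] into three parts, each missing that color, so
    induction would give base 3. Base 4 is used because [4 ^ k] is the power of two
    [2 ^ (2 * k)]. *)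
Lemma card_le_palette (T C : finType) (c : T -> T -> C) (V : {set T}) :
  pairwise_3colorable c -> #|V| <= 4 ^ #|palette c V|.
Proof.
move=> cP; have [k] := ubnP #|palette c V|; elim: k => // k IH in V *.
rewrite ltnS => kV; have [V0|[j jV]] := set_0Vmem (palette c V).
  rewrite V0 cards0 leqNgt; apply/negP=> /card_gt1P[u [v [uV vV nuv]]].
  have : c u v \in palette c V by apply/paletteP; exists u, v.
  by rewrite V0 inE.
have [f [fP _]] := cP j j.
have Vs : #|V| = \sum_(a in 'I_3) #|[set v in V | f v == a]|.
  rewrite -sum1_card (partition_big f xpredT) //=; apply: eq_bigr => a _.
  by rewrite -sum1_card; apply: eq_bigl => v; rewrite inE.
have pos : 0 < #|palette c V| by apply/card_gt0P; exists j.
have -> : #|palette c V| = #|palette c V|.-1.+1 by rewrite prednK.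
rewrite Vs; apply: leq_trans (_ : \sum_(a in 'I_3) 4 ^ #|palette c V|.-1 <= _).
  apply: leq_sum => a _; set W := [set v in V | _].
  have WV : W \subset V by apply/subsetP=> v; rewrite inE => /andP[].
  have jW : j \notin palette c W.
    apply: (palette_const fP) => u v; rewrite !inE.
    by case/andP=> _ /eqP-> /andP[_ /eqP->].
  have lose := palette_lt WV jV jW.
  apply: leq_trans (IH W _) _; first by lia.
  by rewrite leq_exp2l //; lia.
by rewrite sum_nat_const card_ord expnS leq_mul2r orbT.
Qed.

(** * Dependent random choice and a densest color *)

Definition nbrs (T : finType) (V : {set T}) (e : rel T) (x : T) : {set T} :=
  [set y in V | e x y].

Definition conbrs (T : finType) (V : {set T}) (e : rel T) (p : T * T) : {set T} :=
  [set x in V | e x p.1 && e x p.2].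

(** The random vertex becomes an average over [x]. With [n] vertices in [V], a bad pair lies in
    fewer than [n / D] neighborhoods, so the bad-pair counts [b x] satisfy that [D] times their sum
    is at most [n ^ 3]. *)
Lemma dependent_random_choice (T : finType) (V : {set T}) (e : rel T) (Q M : nat) :
  #|V| ^ 2 < 2 * Q * \sum_(x in V) #|nbrs V e x| ->
  exists2 x, x \in V & #|V| < 4 * Q * #|nbrs V e x| /\
    M * #|[set p in setX (nbrs V e x) (nbrs V e x) |
            16 * Q ^ 2 * M * #|conbrs V e p| < #|V|]| < #|nbrs V e x| ^ 2.
Proof.
set n := #|V|; set D := 16 * Q ^ 2 * M; set bad := fun p => D * #|conbrs V e p| < n.
set b := fun x => #|[set p in setX (nbrs V e x) (nbrs V e x) | bad p]|.
move=> dense.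
have bsum : D * \sum_(x in V) b x <= n ^ 3.
  have -> : \sum_(x in V) b x = \sum_(p in setX V V | bad p) #|conbrs V e p|.
    under eq_bigr do rewrite /b -sum1_card.
    rewrite (exchange_big_dep (fun p => (p \in setX V V) && bad p)) /=; last first.
      move=> x [u w] xV; rewrite !inE /= => /andP[/andP[/andP[-> _] /andP[-> _]] ->].
      by [].
    apply: eq_bigr => [[u w]] /=; rewrite inE /= => /andP[/andP[uV wV] bp].
    by rewrite -sum1_card; apply: eq_bigl => x; rewrite !inE /= uV wV bp andbT.
  rewrite big_distrr /=; apply: leq_trans (_ : \sum_(p in setX V V) n <= _).
    rewrite [leqRHS](bigID bad) /=; apply: leq_trans (leq_addr _ _).
    by apply: leq_sum => p /andP[_ /ltnW].
  by rewrite sum_nat_const cardsX !expnS expn0 muln1 mulnA.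
(* This single inequality yields both conclusions: dropping [D * b x] gives the degree bound, and
   dropping [n ^ 2] and then inserting the degree bound gives few bad pairs. *)
have [|x xV hx] := @exists_lt_of_sum _ V (fun x => n ^ 2 + D * b x)
                     (fun x => 4 * Q * n * #|nbrs V e x|).
  rewrite big_split /= sum_nat_const -!big_distrr /= -/n.
  apply: leq_ltn_trans (_ : n ^ 3 + n ^ 3 < _).
    by rewrite leq_add //; rewrite expnS.
  move: dense; set S := \sum_(x in V) _ => dense.
  have n0 : 0 < n.
    rewrite lt0n; apply/eqP=> n0; move: dense; rewrite /S.
    by have /eqP := n0; rewrite /n cards_eq0 => /eqP->; rewrite big_set0 muln0.
  by rewrite expnS; nia.
exists x => //; move: hx; rewrite -/(b x); set d := #|_| => hx.
have nd : n < 4 * Q * d by nia.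
split=> //.
have : D * b x < (4 * Q * d) ^ 2 by nia.
have Q0 : 0 < Q by nia.
rewrite /D; set B := b x => h.
have : 16 * Q ^ 2 * (M * B) < 16 * Q ^ 2 * d ^ 2 by nia.
by rewrite ltn_pmul2l //; nia.
Qed.

Lemma dense_color (T C : finType) (c : T -> T -> C) (V : {set T}) :
  1 < #|V| ->
  exists i, #|V| * #|V|.-1 <=
    #|palette c V| * \sum_(x in V) #|nbrs V (fun x y => (x != y) && (c x y == i)) x|.
Proof.
move=> V1; set n := #|V|.
pose e i := \sum_(x in V) #|nbrs V (fun x y => (x != y) && (c x y == i)) x|.
have tot : \sum_(i in palette c V) e i = n * n.-1.
  rewrite exchange_big /= -sum_nat_const; apply: eq_bigr => x xV.
  have := cardsD1 x V; rewrite xV -/n add1n => -> /=.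
  rewrite -sum1_card (partition_big (c x) (mem (palette c V))) /=.
    apply: eq_bigr => i _; rewrite -sum1_card; apply: eq_bigl => y.
    by rewrite !inE eq_sym; case: (y \in V); rewrite ?andbF ?andbT.
  move=> y; rewrite in_setD1 => /andP[nyx yV].
  by apply/paletteP; exists x, y; split=> //; rewrite eq_sym.
have pos : 0 < #|palette c V|.
  have /card_gt1P[u [v [uV vV nuv]]] := V1.
  by apply/card_gt0P; exists (c u v); apply/paletteP; exists u, v.
(* The outer predecessor turns the strict inequality of [exists_lt_of_sum] into the desired weak
   one. *)
have [|i iP h] := @exists_lt_of_sum _ (palette c V) (fun=> (n * n.-1).-1)
   (fun i => #|palette c V| * e i); last by exists i; rewrite -/(e i); lia.
by rewrite -big_distrr /= tot sum_nat_const ltn_pmul2l // prednK // muln_gt0; lia.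
Qed.

(** * Shedding colors by passing to subsets, and well separated pairs *)

(* At most [m] rounds, each giving up a fraction [1 - q/p] of the vertices in
   exchange for one color. *)
Lemma shrink_palette (T C : finType) (c : T -> T -> C) (p q m : nat) (Y : {set T}) :
  exists (Z : {set T}) t, [/\ Z \subset Y, t <= m, #|Y| * q ^ t <= #|Z| * p ^ t,
    t + #|palette c Z| <= #|palette c Y| &
    t = m \/ forall j (W : {set T}), j \in palette c Z -> W \subset Z ->
               j \notin palette c W -> p * #|W| <= q * #|Z|].
Proof.
elim: m Y => [|m IH] Y; first by exists Y, 0; rewrite !muln1; split=> //; left.
have [h|h] := classic (forall j (W : {set T}), j \in palette c Y -> W \subset Y ->
               j \notin palette c W -> p * #|W| <= q * #|Y|).
  by exists Y, 0; rewrite !muln1; split=> //; right.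
have {h} [j [W [jY WY jW lt]]] : exists j (W : {set T}), [/\ j \in palette c Y,
    W \subset Y, j \notin palette c W & q * #|Y| < p * #|W|].
  apply: NNPP => h'; apply: h => j W jY WY jW; rewrite leqNgt; apply/negP=> lt.
  by apply: h'; exists j, W.
have lose := palette_lt WY jY jW.
have [Z [t [ZW tm sz pal fin]]] := IH W.
exists Z, t.+1; split=> //; [exact: subset_trans WY| |by lia|].
  rewrite !expnS; apply: leq_trans (_ : p * #|W| * q ^ t <= _).
    by rewrite mulnA leq_mul2r mulnC ltnW ?orbT.
  by rewrite -mulnA [leqRHS]mulnCA leq_mul2l sz orbT.
by case: fin => [->|h]; [left|right].
Qed.

(** For fixed [u], the vertices of [Z] in the class of [u] span no edge of color [j], so by
    hypothesis they leave out at least a fraction [1/(p+1)] of [Z]. *)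
Lemma card_class_le (T C : finType) (c : T -> T -> C) (p : nat) (Z : {set T})
    (j : C) (f : T -> 'I_3) :
  proper_for c j f -> j \in palette c Z ->
  (forall W : {set T}, W \subset Z -> j \notin palette c W ->
     p.+1 * #|W| <= p * #|Z|) ->
  #|Z| ^ 2 <= p.+1 * #|[set e in setX Z Z | f e.1 != f e.2]|.
Proof.
move=> fP jZ h.
have -> : #|[set e in setX Z Z | f e.1 != f e.2]| =
          \sum_(u in Z) #|[set w in Z | f u != f w]|.
  under eq_bigr do rewrite -sum1_card.
  rewrite pair_big_dep /= -sum1_card; apply: eq_bigl => [[u w]].
  by rewrite !inE /= andbA.
rewrite big_distrr /= expnS expn1 -sum_nat_const; apply: leq_sum => u uZ.
have := cardsID [set w | f u == f w] Z.
set W := Z :&: _.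
have -> : Z :\: [set w | f u == f w] = [set w in Z | f u != f w].
  by apply/setP=> w; rewrite !inE andbC.
have : p.+1 * #|W| <= p * #|Z|.
  apply: h; first exact: subsetIl.
  apply: (palette_const fP) => v w; rewrite !inE.
  by case/andP=> _ /eqP<- /andP[_ /eqP<-].
by nia.
Qed.

(* If every pair that is not bad were separated by at most [K] of the [F j], counting
   the triples [(u, w, j)] in two ways would make the palette of [Z] too small. *)
Lemma separated_pair (T C : finType) (c : T -> T -> C) (p Q K : nat)
    (Y Z : {set T}) (F : C -> T -> 'I_3) (bad : pred (T * T)) :
  0 < #|Z| -> 0 < Q -> Z \subset Y -> #|Y| <= #|Z| * Q ->
  (forall j, proper_for c j (F j)) ->
  (forall j (W : {set T}), j \in palette c Z -> W \subset Z ->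
     j \notin palette c W -> p.+1 * #|W| <= p * #|Z|) ->
  2 * p.+1 * Q ^ 2 * #|[set e in setX Y Y | bad e]| < #|Y| ^ 2 ->
  2 * p.+1 * K < #|palette c Z| ->
  exists e, [/\ e.1 \in Z, e.2 \in Z, ~~ bad e &
    K < #|[set j in palette c Z | F j e.1 != F j e.2]|].
Proof.
move=> Z0 Q0 ZY YZ FP noshrink few many.
pose s (e : T * T) := #|[set j in palette c Z | F j e.1 != F j e.2]|.
apply: NNPP => none.
have sle e : e \in setX Z Z -> ~~ bad e -> s e <= K.
  move=> eZ be; rewrite leqNgt; apply/negP=> h; apply: none; exists e.
  by case: e eZ be h => u w /=; rewrite inE => /andP[uZ wZ] be h; split.
have sk e : s e <= #|palette c Z|.
  by apply: subset_leq_card; apply/subsetP=> j; rewrite in_set => /andP[].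
have cnt : \sum_(e in setX Z Z) s e =
    \sum_(j in palette c Z) #|[set e in setX Z Z | F j e.1 != F j e.2]|.
  rewrite /s; under eq_bigr do rewrite -sum1_card.
  under [RHS]eq_bigr do rewrite -sum1_card.
  rewrite (exchange_big_dep (mem (palette c Z))) /=; last first.
    by move=> e j _; rewrite in_set => /andP[].
  by apply: eq_bigr => j jZ; apply: eq_bigl => e; rewrite [RHS]in_set [j \in _]in_set jZ.
have low : #|palette c Z| * #|Z| ^ 2 <= p.+1 * \sum_(e in setX Z Z) s e.
  rewrite cnt big_distrr /= -sum_nat_const; apply: leq_sum => j jZ.
  by apply: (@card_class_le _ _ c) => // W; apply: noshrink.
set b := #|[set e in setX Y Y | bad e]| in few.
have up : \sum_(e in setX Z Z) s e <= #|Z| ^ 2 * K + b * #|palette c Z|.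
  rewrite (bigID bad) /= addnC; apply: leq_add.
    apply: leq_trans (_ : \sum_(e in setX Z Z) K <= _); last first.
      by rewrite sum_nat_const cardsX !expnS expn0 muln1.
    rewrite [leqRHS](bigID bad) /=; apply: leq_trans (leq_addl _ _).
    by apply: leq_sum => e /andP[eZ be]; apply: sle.
  rewrite /b -sum_nat_const [leqRHS](bigID (mem (setX Z Z))) /=.
  apply: leq_trans (leq_addr _ _).
  apply: leq_trans (_ : \sum_(e in setX Z Z | bad e) #|palette c Z| <= _).
    by apply: leq_sum.
  apply: eq_leq; apply: eq_bigl => [[u w]]; rewrite !inE /=.
  have ZYu v : v \in Z -> v \in Y := subsetP ZY v.
  case uZ: (u \in Z); last by rewrite andbF.
  case wZ: (w \in Z); last by rewrite /= !andbF.
  by rewrite (ZYu u uZ) (ZYu w wZ) /= andbT.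
(* Passing from [Y] to [Z] costs at most [Q ^ 2] in the number of pairs, so the bad pairs account
   for at most half of the lower bound [low]. The other half forces
   [#|palette c Z| <= 2 * p.+1 * K]. *)
have bz : 2 * p.+1 * b <= #|Z| ^ 2.
  rewrite -(@leq_pmul2r (Q ^ 2)) ?expn_gt0 ?Q0 //.
  apply: leq_trans (_ : #|Y| ^ 2 <= _); first by lia.
  by rewrite -expnMn leq_sqr.
move: low up bz many Z0; set k := #|palette c Z|; set z := #|Z|.
move: (\sum_(e in _) _) => S; move: p.+1 => P.
clear; move=> low up bz many z0.
have z2 : 0 < z ^ 2 by rewrite expn_gt0 z0.
move: (z ^ 2) low up bz z2 => x low up bz z2.
have : 2 * k * x <= 2 * P * K * x + k * x by nia.
by nia.
Qed.

(** * Numerical estimates for the induction *)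

(** Bernoulli's inequality for [(1 - 1/(q+1)) ^ m], cleared of denominators. *)
Lemma bernoulli_nat (q m : nat) :
  m <= q.+1 -> q.+1 ^ m * (q.+1 - m) <= q ^ m * q.+1.
Proof.
elim: m => [|m IH] mq; first by rewrite !expn0 !mul1n subn0.
have {IH} := IH (ltnW mq); rewrite !expnS.
have [d ->] : exists d, q = m + d by exists (q - m); lia.
have -> : (m + d).+1 - m = d.+1 by lia.
have -> : (m + d).+1 - m.+1 = d by lia.
move: (_ ^ m) (_ ^ m) => x y; nia.
Qed.

(** By Bernoulli, [b] rounds with ratio [1 - 1/(2b)] keep at least half of the vertices; hence
    [l * b] rounds, or fewer, cost at most a factor [2 ^ l]. *)
Lemma pow_ratio_le (b l t : nat) :
  0 < b -> t <= l * b -> (b.*2) ^ t <= 2 ^ l * b.*2.-1 ^ t.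
Proof.
move=> b0 tl; set q := b.*2.-1.
have qb : b.*2 = q.+1 by rewrite /q; lia.
have q0 : 0 < q by rewrite /q; lia.
have hb : b.*2 ^ b <= 2 * q ^ b.
  have := @bernoulli_nat q b; rewrite -qb.
  have -> : b.*2 - b = b by lia.
  have -> : q ^ b * b.*2 = 2 * q ^ b * b by lia.
  by rewrite leq_pmul2r //; apply; lia.
have : b.*2 ^ (l * b) <= 2 ^ l * q ^ (l * b).
  rewrite ![l * b]mulnC !expnM -expnMn.
  by have [->//|l0] := posnP l; rewrite leq_exp2r.
rewrite -{1 2}(subnKC tl) !expnD => h.
rewrite -(@leq_pmul2r (q ^ (l * b - t))) ?expn_gt0 ?q0 // -mulnA.
apply: leq_trans h; rewrite leq_mul2l; apply/orP; right.
by have [->//|d0] := posnP (l * b - t); rewrite leq_exp2r // qb.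
Qed.

(* The constants are tuned so that trading [l * b] colors for a factor [2 ^ (6 * l)] is
   affordable, while [b] stays of order [sqrt (k / l)]. *)
Lemma step_parameters (h k l : nat) :
  0 < l -> 4096 * k * l <= h ^ 2 -> h.-1 ^ 2 < 4096 * k * l -> h < 2 * k ->
  exists2 b, 0 < b &
    [/\ 6 * l <= h, l * b <= k, 4096 * (k - l * b) * l <= (h - 6 * l) ^ 2,
        4 * b * (l * b) <= k - l * b & 32 * b <= k].
Proof.
(* Lowering [h] by [6 * l] lowers its square by at most [12 * h * l], so [12 * h <= 4096 * (l * b)]
   is needed. This [b] gives 16 in place of 12, and is small enough for the upper bounds on [b]. *)
move=> l0 hk hmin h2k; exists (h %/ (256 * l)).+1 => //; set b := (h %/ _).+1.
have hl : 2048 * l < h.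
  have : 2048 * l * h.+1 <= 2048 * l * (2 * k) by rewrite leq_mul2l h2k orbT.
  have -> : 2048 * l * (2 * k) = 4096 * k * l by lia.
  move=> /leq_trans/(_ hk); rewrite -mulnn => lh.
  have : 2048 * l * h < h * h.
    by apply: leq_trans lh; rewrite ltn_pmul2l // muln_gt0 l0.
  by rewrite ltn_mul2r => /andP[].
have bl : 256 * l * b.-1 <= h by rewrite /b /= mulnC leq_divM.
have bu : h < 256 * l * b by rewrite /b mulnC ltn_ceil // muln_gt0 l0.
have b8 : 8 < b.
  by rewrite -(@ltn_pmul2l (256 * l)) ?muln_gt0 ?l0 //; lia.
have Kh : 210 * (l * b) <= h.
  have bE : l * b = l * b.-1 + l by rewrite /b mulnS addnC.
  by lia.
have h1 : 10 < h by lia.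
have Kb : 16 * h <= 4096 * (l * b) by lia.
have [K KE] : exists K, l * b = K by exists (l * b).
rewrite KE in Kh Kb *.
have K2 : 5 * (K * K) <= l * k.
  have e1 : 210 * (210 * (K * K)) <= h * h.
    have : (210 * K) * (210 * K) <= h * h by rewrite leq_mul.
    by lia.
  have : h * h <= 2 * (h.-1 * h.-1).
    have [g ->] : exists g, h = g + 10 by exists (h - 10); lia.
    by have -> : (g + 10).-1 = g + 9; [lia|nia].
  by move: hmin; rewrite -mulnn; lia.
have lK : l <= K by rewrite -KE leq_pmulr.
have fourbK : 4 * b * K + K <= k.
  rewrite -(@leq_pmul2l l) //.
  have -> : l * (4 * b * K + K) = 4 * (l * b * K) + l * K by lia.
  rewrite KE.
  have : l * K <= K * K by rewrite leq_mul2r lK orbT.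
  by lia.
have K8 : 8 <= K by rewrite -KE (leq_trans (ltnW b8)) // leq_pmull.
have b32 : 32 * b <= 4 * b * K.
  have -> : 4 * b * K = 4 * K * b by lia.
  by rewrite leq_mul2r; apply/orP; right; lia.
split; [by lia|by lia| |by lia|by lia].
rewrite mulnBr mulnBl leq_subLR; apply: (leq_trans hk).
have [g hg] : exists g, h = g + 6 * l by exists (h - 6 * l); lia.
have -> : h - 6 * l = g by lia.
have : 16 * h * l <= 4096 * K * l by rewrite leq_mul2r Kb orbT.
by rewrite hg -!mulnn; lia.
Qed.

(** * The upper bound by induction on the palette *)

Lemma ord3_third (a b y z : 'I_3) :
  a != b -> y != a -> y != b -> z != a -> z != b -> y = z.
Proof.
move=> ab ya yb za zb; apply: val_inj.
move: ab ya yb za zb; rewrite -!val_eqE /=.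
by have := (ltn_ord a, ltn_ord b, ltn_ord y, ltn_ord z) => -[[[]]]; lia.
Qed.

(* Every common neighbor is joined in color [i] to both [u] and [w], so it avoids
   two of the three classes of [f]. *)
Lemma palette_conbrs (T C : finType) (c : T -> T -> C) (V : {set T}) (i j : C)
    (f : T -> 'I_3) (u w : T) :
  proper_for c i f -> proper_for c j f -> f u != f w ->
  j \notin palette c (conbrs V (fun x y => (x != y) && (c x y == i)) (u, w)).
Proof.
move=> fi fj fuw; apply: (palette_const fj) => y z; rewrite !inE /=.
case/and3P=> _ /andP[yu /eqP cyu] /andP[yw /eqP cyw].
case/and3P=> _ /andP[zu /eqP czu] /andP[zw /eqP czw].
exact: (ord3_third fuw (fi _ _ yu cyu) (fi _ _ yw cyw) (fi _ _ zu czu) (fi _ _ zw czw)).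
Qed.

(** Strong induction on the palette of [V], with [l] fixed and [h] varying. A subset with
    [K = l * b] fewer colors satisfies the bound with [h - 6 * l], so losing a factor of at most
    [Q ^ 6], where [Q = 2 ^ l], is affordable. *)
Lemma card_le_pow2 (T C : finType) (c : T -> T -> C) (l : nat) (V : {set T}) (h : nat) :
  pairwise_3colorable c -> 0 < l -> #|C| <= 2 ^ l ->
  4096 * #|palette c V| * l <= h ^ 2 -> #|V| <= 2 ^ h.
Proof.
move=> cP l0 Cl; have [k] := ubnP #|palette c V|; elim: k => // k IH in V h *.
rewrite ltnS => Vk hV.
(* Taking [h] minimal makes it close to [sqrt (4096 * k * l)], as [step_parameters] requires. *)
have [h0 h0V h0min] := ex_minnP (ex_intro (fun m => 4096 * #|palette c V| * l <= m ^ 2) h hV).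
apply: leq_trans (_ : 2 ^ h0 <= _); last by rewrite leq_exp2l // h0min.
move: {h hV} h0 h0V h0min => h hV hmin.
have [kh|kh] := leqP (2 * #|palette c V|) h.
  apply: leq_trans (card_le_palette V cP) _.
  by rewrite -[4]/(2 ^ 2) -expnM leq_exp2l.
have hmin' : h.-1 ^ 2 < 4096 * #|palette c V| * l.
  rewrite ltnNge; apply/negP=> /hmin; case: (h) kh hV => [|m] /=; last by lia.
  by rewrite exp0n // leqn0 !muln_eq0 /= => p0; lia.
have [b b0] := step_parameters l0 hV hmin' kh.
have [K KE] : exists K, l * b = K by exists (l * b).
have [Q QE] : exists Q, 2 ^ l = Q by exists (2 ^ l).
rewrite KE; case=> h6l Kk hK bK b32.
set kV := #|palette c V| in Vk kh hV hmin' Kk hK bK b32.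
have K0 : 0 < K by rewrite -KE muln_gt0 l0.
have Q2 : 1 < Q by rewrite -QE -[1]/(2 ^ 0) ltn_exp2l.
have IHK W : #|palette c W| <= kV - K -> #|W| <= 2 ^ (h - 6 * l).
  move=> Wk; apply: IH.
    by apply: leq_ltn_trans Wk (leq_trans _ Vk); rewrite ltn_subrL K0 (leq_trans K0).
  apply: leq_trans hK; rewrite leq_mul2r leq_mul2l Wk.
  by rewrite !orbT.
have Q6 : Q ^ 6 * 2 ^ (h - 6 * l) = 2 ^ h.
  by rewrite -QE -expnM -expnD mulnC subnKC.
rewrite leqNgt; apply/negP => Vh.
set n := #|V| in Vh.
have n2 : 2 < n.
  apply: leq_ltn_trans Vh; by rewrite -[2]/(2 ^ 1) leq_exp2l // (leq_trans _ h6l) // muln_gt0.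
have kQ : kV <= Q by rewrite -QE (leq_trans (max_card _)).
have [i hi] := @dense_color _ _ c V (ltnW n2).
set e : rel T := fun x y => (x != y) && (c x y == i) in hi.
have [p pb] : exists p, p.+1 = b.*2.
  by exists b.*2.-1; rewrite prednK // double_gt0.
(* This [M] turns the bad-pair bound of dependent random choice into the hypothesis of
   [separated_pair]. *)
set M := 2 * p.+1 * Q ^ 2.
have [|x xV [nY few]] := @dependent_random_choice _ V e Q M.
  move: hi; rewrite -/n -/kV; set S := \sum_(x in V) _ => hi.
  have : n * n.-1 <= Q * S by apply: leq_trans hi _; rewrite leq_mul2r kQ orbT.
  have : n * n < 2 * (n * n.-1) by rewrite mulnCA ltn_pmul2l; lia.
  by rewrite -mulnn; lia.
set Y := nbrs V e x in nY few.
set bad : pred (T * T) := fun q => 16 * Q ^ 2 * M * #|conbrs V e q| < n.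
have [F FP] : exists F : C -> T -> 'I_3,
    forall j, proper_for c i (F j) /\ proper_for c j (F j).
  exact: (@fin_all_exists C (fun=> T -> 'I_3)
            (fun j f => proper_for c i f /\ proper_for c j f) (cP i)).
(* The ratio is [1 - 1/(2b)] and there are at most [l * b] rounds, so [Z] is smaller than [Y] by a
   factor of at most [Q]. *)
have [Z [t [ZY tK sz pal fin]]] := shrink_palette c p.+1 p K Y.
have p0 : 0 < p by rewrite -ltnS pb -[2]/(1.*2) leq_double.
have YZ : #|Y| <= #|Z| * Q.
  rewrite -(@leq_pmul2r (p ^ t)) ?expn_gt0 ?p0 // -mulnA.
  apply: leq_trans sz _; have := @pow_ratio_le b l t b0; rewrite KE QE -pb => /(_ tK) /= pq.
  by rewrite leq_mul2l pq orbT.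
have YV : Y \subset V by apply/subsetP=> y; rewrite inE => /andP[].
have palY : #|palette c Y| <= kV by rewrite subset_leq_card // palette_sub.
(* Otherwise the induction hypothesis for [Z] bounds [n] by [4 * Q ^ 2 * 2 ^ (h - 6 * l)], which is
   at most [2 ^ h]. *)
have manyZ : kV - K < #|palette c Z|.
  rewrite ltnNge; apply/negP=> /IHK Zh.
  have : 4 * Q * (#|Z| * Q) <= Q ^ 6 * 2 ^ (h - 6 * l).
    have -> : 4 * Q * (#|Z| * Q) = 4 * Q ^ 2 * #|Z| by clear; lia.
    apply: leq_mul => //; rewrite -[6]/(4 + 2) expnD leq_mul2r; apply/orP; right.
    by apply: leq_trans (_ : 2 ^ 4 <= _); rewrite ?leq_exp2r.
  rewrite Q6 => hQ.
  have : n < 2 ^ h.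
    apply: leq_trans nY _; apply: leq_trans hQ.
    by rewrite leq_mul2l YZ orbT.
  by rewrite ltnNge ltnW.
(* Running all [K] rounds would contradict [manyZ], so the shrinking stopped early. *)
have noshrink j (W : {set T}) : j \in palette c Z -> W \subset Z ->
    j \notin palette c W -> p.+1 * #|W| <= p * #|Z|.
  case: fin => [tE|]; last exact.
  by have := leq_trans pal palY; rewrite tE -leq_subRL // leqNgt manyZ.
have Z0 : 0 < #|Z|.
  rewrite lt0n; apply/eqP=> Z0; move: YZ nY; rewrite Z0 mul0n leqn0 => /eqP->.
  by rewrite muln0.
have [|[u w] /= [uZ wZ good sep]] := @separated_pair _ _ c p Q K Y Z F bad Z0
   (ltnW Q2) ZY YZ (fun j => proj2 (FP j)) noshrink few.
  rewrite pb -muln2; apply: leq_ltn_trans manyZ; apply: leq_trans bK.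
  by rewrite [b * 2]mulnC mulnA.
set S := [set j in _ | _] in sep.
set B := conbrs V e (u, w).
have BV : B \subset V by apply/subsetP=> y; rewrite inE => /andP[].
have SV : S \subset palette c V.
  apply/subsetP=> j; rewrite inE => /andP[jZ _].
  exact: (subsetP (palette_sub c (subset_trans ZY YV))).
have dSB : [disjoint S & palette c B].
  rewrite disjoint_subset; apply/subsetP=> j; rewrite inE => /andP[_ fuw].
  by case: (FP j) => fi fj; apply: palette_conbrs fi fj fuw.
have palB := palette_lose BV SV dSB.
have /IHK Bh : #|palette c B| <= kV - K 
  by rewrite leq_subRL // (leq_trans _ palB) // leq_add2r ltnW.
(* With [p.+1 = 2 * b] the left side is [64 * b * Q ^ 4], and [32 * b <= kV <= Q]. *)
have DQ : 16 * Q ^ 2 * M <= Q ^ 6.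
  have -> : 16 * Q ^ 2 * M = Q ^ 4 * (64 * b).
    by rewrite /M pb; clear; rewrite -muln2; move: Q b => x y; lia.
  rewrite -[6]/(4 + 2) expnD leq_mul2l; apply/orP; right.
  rewrite -mulnn; apply: leq_trans (_ : 2 * Q <= _).
    by rewrite -[64]/(2 * 32) -mulnA leq_mul2l (leq_trans b32).
  by rewrite leq_mul2r Q2 orbT.
move: good; rewrite /bad -leqNgt -/B => nB.
have : n <= 2 ^ h by rewrite -Q6 (leq_trans nB) // leq_mul.
by rewrite leqNgt Vh.
Qed.

(** * Colorings that witness the failure of [Fchi_prop] *)

(** Delete pairs until one more deletion would give a 3-coloring; a fourth color on one end of that
    last pair then shows that the chromatic number is exactly 4. *)
Lemma critical_subgraph (n : nat) (E : {set 'I_n * 'I_n}) :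
  loopless E -> ~ colorable 3 E ->
  exists2 E' : {set 'I_n * 'I_n}, E' \subset E & p_chromatic 4 E'.
Proof.
have [k] := ubnP #|E|; elim: k => // k IH in E *; rewrite ltnS => Ek Eloop E3.
have [E0|[e eE]] := set_0Vmem E.
  by case: E3; exists (fun=> ord0) => e; rewrite E0 inE.
have sE : E :\ e \subset E by exact: subD1set.
have [[f fP]|E3'] := classic (colorable 3 (E :\ e)); last first.
  have [||//|E' E'E E'4] := IH (E :\ e).
  - by move: Ek; rewrite (cardsD1 e E) eE.
  - by move=> e' /(subsetP sE); apply: Eloop.
  - by exists E' => //; apply: subset_trans sE.
exists E => //; split=> //.
exists (fun v => if v == e.1 then ord_max else widen_ord (leqnSn 3) (f v)) => e' e'E.
have ne' := Eloop _ e'E; have ne := Eloop _ eE.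
have nmax v : widen_ord (leqnSn 3) (f v) != ord_max.
  by rewrite -val_eqE /= neq_ltn ltn_ord.
have [e1|e1] := eqVneq e'.1 e.1.
  by rewrite -e1 (eq_sym e'.2) (negbTE ne') eq_sym.
have [e2|e2] := eqVneq e'.2 e.1; first exact: nmax.
rewrite -val_eqE /= val_eqE; apply: fP; rewrite !inE e'E andbT.
by apply: contra_neq e1 => ->.
Qed.

Lemma not_Fchi_prop_coloring (r n : nat) :
  ~ Fchi_prop r 4 3 n ->
  exists c : 'I_n -> 'I_n -> 'I_r, pairwise_3colorable c.
Proof.
move=> fail; have [c c_fails] := not_all_ex_not _ _ fail; exists c => i j.
have [csym none] := imply_to_and _ _ c_fails.
pose E := [set e : 'I_n * 'I_n | (e.1 != e.2) && ((c e.1 e.2 == i) || (c e.1 e.2 == j))].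
have Eloop : loopless E by move=> e; rewrite inE => /andP[].
have [[f fP]|E3] := classic (colorable 3 E).
  by exists f; split=> u v nuv cuv; apply: (fP (u, v)); rewrite inE nuv cuv eqxx ?orbT.
have [E' E'E E'4] := critical_subgraph Eloop E3.
case: none; exists E'; split=> //.
  by move=> e /(subsetP E'E); apply: Eloop.
apply: leq_trans (_ : #|[set i; j]| <= 2); last by rewrite cards2; case: (_ == _).
apply/subset_leq_card/subsetP=> _ /imsetP[e /(subsetP E'E) eE ->].
by move: eE; rewrite !inE => /andP[].
Qed.

Lemma coloring_not_Fchi_prop (r n : nat) (c : 'I_n -> 'I_n -> 'I_r) :
  sym_coloring c -> pairwise_3colorable c -> ~ Fchi_prop r 4 3 n.
Proof.
move=> csym cP /(_ c csym)[E [Eloop [_ E3] Ecol]]; apply: E3.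
have [E0|[e0 e0E]] := set_0Vmem E.
  by exists (fun=> ord0) => e; rewrite E0 inE.
set i := c e0.1 e0.2; have iS : i \in colors_of c E by apply: imset_f.
have [j Sij] : exists j, forall k, k \in colors_of c E -> k = i \/ k = j.
  have [S0|[j jS]] := set_0Vmem (colors_of c E :\ i).
    exists i => k kS; left; apply/eqP; apply: contraT => ki.
    by have : k \in colors_of c E :\ i by [rewrite in_setD1 ki]; rewrite S0 inE.
  exists j => k kS; have [->|ki] := eqVneq k i; [by left|right].
  have : #|colors_of c E :\ i| <= 1.
    by move: Ecol; rewrite (cardsD1 i) iS.
  by move/card_le1_eqP; apply; rewrite // in_setD1 ki.
have [f [fi fj]] := cP i j; exists f => e eE.
have /Sij[ce|ce] : c e.1 e.2 \in colors_of c E by apply: (imset_f (fun e => c e.1 e.2)).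
  exact: fi (Eloop _ eE) ce.
exact: fj (Eloop _ eE) ce.
Qed.

Lemma transfer_coloring (T C : finType) (c : T -> T -> C) (x0 : C) (n r : nat) :
  (forall u v, c u v = c v u) -> pairwise_3colorable c ->
  n <= #|T| -> #|C| <= r ->
  exists2 c' : 'I_n -> 'I_n -> 'I_r, sym_coloring c' & pairwise_3colorable c'.
Proof.
move=> csym cP nT Cr.
pose h (u : 'I_n) : T := enum_val (widen_ord nT u).
pose g (x : C) : 'I_r := widen_ord Cr (enum_rank x).
have hinj : injective h.
  by move=> u v /enum_val_inj/(congr1 val)/= /val_inj.
have ginj : injective g.
  by move=> x y /(congr1 val)/= /val_inj/enum_rank_inj.
exists (fun u v => g (c (h u) (h v))) => [u v|i j]; first by rewrite csym.
(* The default [x0] serves colors outside the image of [g], which no edge has. *)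
pose g' i := odflt x0 [pick x | g x == i].
have gK x : g' (g x) = x.
  by rewrite /g'; case: pickP => [y /eqP/ginj //|/(_ x)]; rewrite eqxx.
have [f [fi fj]] := cP (g' i) (g' j); exists (f \o h).
by split=> u v nuv cuv; [apply: fi|apply: fj]; rewrite ?(inj_eq hinj) // -cuv gK.
Qed.

(** * Mubayi's coloring and the lower bound *)

(** The default [ord0] is taken only for the all-false [d], which no pair of distinct words
    produces. *)
Definition first_true (t : nat) (d : {ffun 'I_t.+1 -> bool}) : 'I_t.+1 :=
  odflt ord0 [pick k | d k && [forall j, d j ==> (k <= j)]].

(* Mubayi's coloring: the first pair of distinct letters, made unordered by
   sorting, together with the set of positions where the words differ. *)
Definition mubayi (t s : nat) (u v : {ffun 'I_t.+1 -> 'I_s.+1}) :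
    'I_s.+1 * 'I_s.+1 * {ffun 'I_t.+1 -> bool} :=
  let d := [ffun k => u k != v k] in
  let p := first_true d in
  (if u p <= v p then (u p, v p) else (v p, u p), d).

Lemma mubayi_sym (t s : nat) (u v : {ffun 'I_t.+1 -> 'I_s.+1}) :
  mubayi u v = mubayi v u.
Proof.
rewrite /mubayi; have -> : [ffun k => u k != v k] = [ffun k => v k != u k].
  by apply/ffunP=> k; rewrite !ffunE eq_sym.
set p := first_true _; have [uv|vu|/val_inj->//] := ltngtP (u p) (v p);
  by [].
Qed.

Lemma mubayi_edge (t s : nat) (u v : {ffun 'I_t.+1 -> 'I_s.+1}) a b d :
  u != v -> mubayi u v = (a, b, d) ->
  let p := first_true d in
  [/\ u p != v p, u p = a /\ v p = b \/ u p = b /\ v p = a,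
      forall k : 'I_t.+1, k < p -> u k = v k & forall k, d k = (u k != v k)].
Proof.
move=> nuv [] + <-; set d' := [ffun k => _]; set p := first_true d' => abE /=.
have [k0 dk0] : exists k, d' k.
  apply/existsP; apply: contraT; rewrite negb_exists => /forallP eqs.
  case/eqP: nuv; apply/ffunP=> k; apply/eqP.
  by have := eqs k; rewrite ffunE negbK.
have dE k : d' k = (u k != v k) by rewrite ffunE.
have [dp pmin] : d' p /\ forall k, d' k -> p <= k.
  rewrite /p /first_true; case: pickP => [k /andP[dk /forallP kmin]|none] /=.
    by split=> // j dj; have := kmin j; rewrite dj.
  case: (@arg_minnP _ k0 d' val dk0) => k dk kmin; have := none k.
  by rewrite dk => /forallP[] j; apply/implyP/kmin.
split=> //; first by rewrite -dE.
  by move: abE; case: ifP => _ [-> ->]; [left|right].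
move=> k kp; apply/eqP; move: kp; apply: contraTT; rewrite -dE -leqNgt.
exact: pmin.
Qed.

(** Every edge considered meets [a] or [a'], so the remaining letters form an independent set and
    can share the third color. *)
Lemma greedy_path_coloring (A : eqType) (a a' x y : A) (f := fun z : A =>
    if z == a then ord0 else if z == a' then inord 1 else inord 2 : 'I_3) :
  x != y -> (x == a) || (y == a) || (x == a') || (y == a') -> f x != f y.
Proof.
move=> xy h; rewrite /f.
have [xa|xa] := eqVneq x a; have [ya|ya] := eqVneq y a.
- by rewrite xa ya eqxx in xy.
- by case: ifP => _; rewrite -val_eqE /= inordK.
- by case: ifP => _; rewrite -val_eqE /= inordK.
have [xa'|xa'] := eqVneq x a'; have [ya'|ya'] := eqVneq y a'.
- by rewrite xa' ya' eqxx in xy.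
- by rewrite -val_eqE /= !inordK.
- by rewrite -val_eqE /= !inordK.
by move: h; rewrite (negbTE xa) (negbTE ya) (negbTE xa') (negbTE ya').
Qed.

Lemma endpoint_eq (A : eqType) (a b x y : A) :
  x != y -> x = a /\ y = b \/ x = b /\ y = a ->
  (x == a) = ~~ (y == a) /\ (x == b) = ~~ (y == b).
Proof.
move=> xy ends; case: ends xy => -[-> ->] ab;
  by rewrite !eqxx (negbTE ab) eq_sym (negbTE ab).
Qed.

Lemma mubayi_pairwise_3colorable (t s : nat) :
  pairwise_3colorable (@mubayi t s).
Proof.
move=> [[a b] d] [[a' b'] d'].
wlog: a b d a' b' d' / first_true d <= first_true d'.
  move=> H; have [le|/ltnW lt] := leqP (first_true d) (first_true d').
    exact: H.
  by have [f [fi fj]] := H a' b' d' a b d lt; exists f.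
set p := first_true d; set p' := first_true d'.
rewrite leq_eqVlt => /orP[/eqP/val_inj pp|pp].
  (* Equal first positions: both colors are decided by the letter there, and their two letter pairs
     are covered by [a] and [a']. *)
  exists (fun v : {ffun 'I_t.+1 -> 'I_s.+1} =>
    if v p == a then ord0 else if v p == a' then inord 1 else inord 2 : 'I_3).
  split=> u v nuv /(mubayi_edge nuv) /= [ne ends _ _]; apply: greedy_path_coloring.
  - exact: ne.
  - by case: ends => [[-> _]|[_ ->]]; rewrite eqxx ?orbT.
  - by rewrite -/p' -pp in ne.
  - by rewrite -/p' -pp in ends; case: ends => [[-> _]|[_ ->]]; rewrite eqxx ?orbT.
case dp' : (d p').
  (* Edges of the first color differ at [p'], so at most one end has [b'] there; if neither does,
     the test for [a] at [p] separates them. Edges of the second color have [b'] at exactly one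
     end. *)
  exists (fun v : {ffun 'I_t.+1 -> 'I_s.+1} =>
    if v p' == b' then ord_max else if v p == a then ord0 else inord 1 : 'I_3).
  split=> u v nuv /(mubayi_edge nuv) /= [ne ends before diff].
    have [ea _] := endpoint_eq ne ends; rewrite -/p in ea.
    have := diff p'; rewrite dp' => /esym np'.
    have [ub|_] := eqVneq (u p') b'; have [vb|_] := eqVneq (v p') b'.
    - by rewrite ub vb eqxx in np'.
    - by case: ifP => _; rewrite -val_eqE /= ?inordK.
    - by case: ifP => _; rewrite -val_eqE /= ?inordK.
    - by rewrite ea; case: (v p == a); rewrite -val_eqE /= inordK.
  have [_ eb] := endpoint_eq ne ends; rewrite -/p' in eb.
  by rewrite eb; case: (v p' == b') => /=; case: ifP => _; rewrite -val_eqE /= ?inordK.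
(* Edges of the first color agree at [p'], those of the second agree at [p]; each flips exactly one
   of the two tests, hence their exclusive or. *)
exists (fun v : {ffun 'I_t.+1 -> 'I_s.+1} =>
    if (v p == a) (+) (v p' == a') then ord0 else ord_max : 'I_3).
split=> u v nuv /(mubayi_edge nuv) /= [ne ends before diff].
  have [ea _] := endpoint_eq ne ends; rewrite -/p in ea.
  have /eqP up' : u p' == v p' by have := diff p'; rewrite dp' => /esym/negbFE.
  by rewrite ea up'; case: (v p == a); case: (v p' == a').
have [ea _] := endpoint_eq ne ends; rewrite -/p' in ea.
by rewrite ea (before p pp); case: (v p == a); case: (v p' == a').
Qed.

Lemma mubayi_not_Fchi_prop (t r n : nat) :
  2 ^ (3 * t.+1) <= r -> n <= 2 ^ (t.+1 * t.+1) -> ~ Fchi_prop r 4 3 n.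
Proof.
move=> tr nt; pose s := (2 ^ t.+1).-1.
have sE : s.+1 = 2 ^ t.+1 by rewrite prednK ?expn_gt0.
have [||||c csym cP] := @transfer_coloring _ _ (@mubayi t s) (ord0, ord0, [ffun=> false]) n r.
- exact: mubayi_sym.
- exact: mubayi_pairwise_3colorable.
- by rewrite card_ffun !card_ord sE -expnM.
- rewrite !card_prod card_ffun !card_ord card_bool sE -!expnD.
  by apply: leq_trans tr; rewrite !mulSn mul0n addn0 addnA.
exact: coloring_not_Fchi_prop csym cP.
Qed.

(** * Bounds on the least [n] in natural numbers *)

Lemma Fchi_fail_le (r n l h : nat) :
  0 < l -> r <= 2 ^ l -> 4096 * r * l <= h ^ 2 -> ~ Fchi_prop r 4 3 n -> n <= 2 ^ h.
Proof.
move=> l0 rl rh /not_Fchi_prop_coloring[c cP].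
have := @card_le_pow2 _ _ c l [set: 'I_n] h cP l0.
rewrite cardsT !card_ord; apply=> //; apply: leq_trans rh.
by rewrite leq_mul2r leq_mul2l (leq_trans (max_card _)) ?card_ord // !orbT.
Qed.

Lemma is_Fchi_exists (r p q : nat) :
  (exists n, Fchi_prop r p q n) -> exists n, is_Fchi r p q n.
Proof.
case=> n; have [k] := ubnP n; elim: k => // k IH in n *; rewrite ltnS => nk Fn.
have [[m [mn Fm]]|none] := classic (exists m, m < n /\ Fchi_prop r p q m).
  by apply: IH Fm; apply: leq_trans nk.
by exists n; split=> // m mn Fm; apply: none; exists m.
Qed.

Lemma is_Fchi_bounds (t l h r : nat) :
  2 ^ (3 * t.+1) <= r -> 0 < l -> r <= 2 ^ l -> 4096 * r * l <= h ^ 2 ->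
  exists n, [/\ is_Fchi r 4 3 n, 2 ^ (t.+1 * t.+1) <= n & n <= 2 * 2 ^ h].
Proof.
move=> tr l0 rl rh.
have [|n Fn] := @is_Fchi_exists r 4 3.
  exists (2 ^ h).+1; apply: NNPP => /(Fchi_fail_le l0 rl rh).
  by rewrite ltnn.
have [Fn1 Fn2] := Fn.
exists n; split=> //.
  by rewrite leqNgt; apply/negP => /ltnW/(mubayi_not_Fchi_prop tr).
(* Minimality bounds only the predecessor of the least value by [2 ^ h]; the factor 2 absorbs the
   extra 1. *)
case: n Fn Fn1 Fn2 => // n _ _ /(_ n (leqnn _)) /(Fchi_fail_le l0 rl rh) nh.
by rewrite mul2n -addnn -addn1 leq_add // expn_gt0.
Qed.

(** * Passage to real exponents and logarithms *)

Lemma INR_exp2 (m : nat) : INR (2 ^ m) = Rpower 2 (INR m).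
Proof.
rewrite Rpower_pow; last lra.
by elim: m => [|m IH]; rewrite ?expn0 // expnS mult_INR IH.
Qed.

Lemma leq_INR (m n : nat) : m <= n -> Rle (INR m) (INR n).
Proof. by move=> mn; apply: le_INR; lia. Qed.

Lemma log2_Rpower (x : R) : log2 (Rpower 2 x) = x.
Proof. by rewrite /log2 ln_Rpower; field; have := ln_lt_2; lra. Qed.

Lemma log2_le (x y : R) : Rlt 0 x -> Rle x y -> Rle (log2 x) (log2 y).
Proof.
move=> x0 xy; rewrite /log2; apply: Rmult_le_compat_r.
  by apply/Rlt_le/Rinv_0_lt_compat; have := ln_lt_2; lra.
by case: xy => [/(ln_increasing _ _ x0)/Rlt_le|->] //; apply: Rle_refl.
Qed.

Lemma trunc_log2_bounds (r : nat) : 0 < r ->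
  Rle (INR (trunc_log 2 r)) (log2 (INR r)) /\
  Rle (log2 (INR r)) (Rplus (INR (trunc_log 2 r)) 1).
Proof.
move=> r0; split.
  rewrite -[X in Rle X _]log2_Rpower; apply: log2_le; first exact: exp_pos.
  by rewrite -INR_exp2; apply/leq_INR/trunc_logP.
rewrite -S_INR -[X in Rle _ X]log2_Rpower; apply: log2_le.
  by apply: lt_0_INR; lia.
by rewrite -INR_exp2; apply/leq_INR/ltnW/trunc_log_ltn.
Qed.

Theorem theorem1p6 :
  exists C r0 : R, Rlt 0 C /\ Rlt 0 r0 /\
    forall r : nat, Rle r0 (INR r) ->
      exists n : nat, is_Fchi r 4 3 n /\
        Rle (Rpower 2 (Rdiv (pow (log2 (INR r)) 2) 36)) (INR n) /\
        Rle (INR n)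
            (Rmult C (Rpower 2 (Rmult 130 (sqrt (Rmult (INR r) (log2 (INR r))))))).
Proof.
(* From [r >= 8] the integer part [a] of the logarithm is at least 3, so the word length [a %/ 3] is
   positive. *)
exists (2 : R), (8 : R); split; [lra|split; [lra|]] => r r8.
have r8' : 2 ^ 3 <= r.
  by apply/leP/INR_le; apply: Rle_trans r8; rewrite /=; lra.
have r0 : 0 < r by apply: leq_trans r8'.
set a := trunc_log 2 r; have [aL La] := trunc_log2_bounds r0; rewrite -/a in aL La.
have a3 : 3 <= a by rewrite trunc_log_max.
have [t tE] : exists t, a %/ 3 = t.+1 by exists (a %/ 3).-1; rewrite prednK // divn_gt0.
have t3 : 3 * t.+1 <= a by rewrite -tE mulnC leq_divM.
have a6 : a < 3 * t.+1 + 3.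
  by have := ltn_ceil a (isT : 0 < 3); rewrite tE; lia.
have ex_h : exists m, 4096 * r * a.+1 <= m ^ 2.
  by exists (4096 * r * a.+1); rewrite -mulnn leq_pmulr // !muln_gt0 r0.
have [h rh hmin] := ex_minnP ex_h.
have h0 : 0 < h.
  by rewrite lt0n; apply/eqP => h0; move: rh; rewrite h0 leqn0 !muln_eq0 -[r == 0]leqn0 leqNgt r0.
have hmin' : h.-1 * h.-1 <= 4096 * r * a.+1.
  by rewrite mulnn leqNgt; apply/negP => /ltnW/hmin; rewrite -{1}(prednK h0) ltnn.
have tr : 2 ^ (3 * t.+1) <= r.
  by apply: leq_trans (trunc_logP (isT : 1 < 2) r0); rewrite leq_exp2l.
have [n [Fn low up]] := is_Fchi_bounds tr (isT : 0 < a.+1)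
  (ltnW (trunc_log_ltn r (isT : 1 < 2))) rh.
exists n; split=> //.
have INR_a3 : Rle 3 (INR a) by have := leq_INR a3; rewrite /=; lra.
split.
  apply: Rle_trans (leq_INR low); rewrite INR_exp2; apply: Rle_Rpower; first lra.
  have := leq_INR a6; rewrite (S_INR a) plus_INR !mult_INR (S_INR t).
  have := pos_INR t; move: (INR t) => x; rewrite [INR 3]/= => x0 a6R.
  (* The logarithm is at most [a + 1], hence at most [3 * (t + 1) + 3]; squaring this bound by
     [6 * (t + 1)] gives the 36. *)
  have L6 : Rle (log2 (INR r)) (Rmult 6 (Rplus x 1)) by lra.
  by nra.
apply: Rle_trans (leq_INR up) _; rewrite mult_INR INR_exp2.
apply: Rmult_le_compat_l; first by rewrite /=; lra.
apply: Rle_Rpower; first lra.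
set S := sqrt _.
have SS : Rmult S S = Rmult (INR r) (log2 (INR r)) by apply: sqrt_sqrt; nra.
have S0 : Rle 0 S := sqrt_pos _.
have S1 : Rle 1 S by nra.
have := leq_INR hmin'; rewrite !mult_INR (S_INR a) => hR.
have := S_INR h.-1; rewrite prednK // => ->.
have := pos_INR h.-1; move: (INR h.-1) hR => g hR g0.
have E4096 : INR 4096 = (4096 : R) by rewrite INR_IZR_INZ.
rewrite {}E4096 in hR.
(* Since [a + 1] is at most 4/3 of the logarithm, 9216, the square of 96, leaves room. Then
   [h <= 96 * S + 1 <= 130 * S]. *)
have gS : Rle (Rmult g g) (Rmult (Rmult 96 S) (Rmult 96 S)).
  apply: Rle_trans hR _.
  have -> : Rmult (Rmult 96 S) (Rmult 96 S) = Rmult 9216 (Rmult S S) by ring.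
  by rewrite SS; nra.
have := Rsqr_incr_0 _ _ gS g0 ltac:(lra); lra.
Qed.
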